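(* Let $N\ge 1$ be an integer, let $\beta_1,\beta_2,\alpha_1,\dots,\alpha_N$ be real numbers and let $x_1,\dots,x_N<1$ be real. With $P$, $W$, the coefficients $d_k,e_k,d_k(p),e_k(p)$ and the integrals $I_n$, $I_{n,p}$ as defined in the context, the following identities hold. (1) If $\beta_1>-1$, $\beta_2>-1$, then for every integer $n\ge 0$, $$\sum_{k=0}^{N+1}(n\,d_{k+1}+e_k)\,I_{k+n}=0 .$$ (2) If $\beta_1>-1$, $\beta_2>-1$, then for every integer $n$ and every real $p<1$ with $p\ne 0$ and $p\notin\{x_1,\dots,x_N\}$, $$\sum_{k=0}^{N+2}\bigl[-np\,d_k(p)+e_{k-1}(p)\bigr]\,I_{k+n-1,p}=0 ,$$ where $e_{-1}(p):=0$. (3) Let $n$ be an integer and suppose that either $p=1$, $\beta_1>-1$ and $\beta_2+n>-1$, or $p=x_i$ for some $i\in\{1,\dots,N\}$ with $x_i\neq 0$, $\beta_1>-1$ and $\beta_2>-1$. Then $$\sum_{k=0}^{N+1}\bigl(-np\,d_{k+1}(p)+e_k(p)\bigr)\,I_{k+n,p}=0 .$$ Moreover, $d_k,e_k$ are polynomials in $x_1,\dots,x_N$, and $d_k(p),e_k(p)$ (with $p$ regarded as an independent variable) are polynomial in $x_1,\dots,x_N$ and rational in $p$.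
   Context: Put $$K(t)=t^{\beta_1}(1-t)^{\beta_2}\prod_{i=1}^N(1-x_it)^{\alpha_i},\qquad P(t)=t(1-t)\prod_{i=1}^N(1-x_it),$$ $$W(t)=(\beta_1+1)(1-t)\prod_{j=1}^N(1-x_jt)-(\beta_2+1)\,t\prod_{j=1}^N(1-x_jt)-\sum_{l=1}^N(\alpha_l+1)x_l\,t(1-t)\prod_{j\ne l}(1-x_jt).$$ The coefficients $d_k=d_k(x_1,\dots,x_N)$ and $e_k=e_k(x_1,\dots,x_N)$ are defined by $P(t)=\sum_{k=1}^{N+2}d_kt^k$ and $W(t)=\sum_{k=0}^{N+1}e_kt^k$. For $p\ne0$ let $u=1-pt$; the coefficients $d_k(p)=d_k(p,x_1,\dots,x_N)$ and $e_k(p)=e_k(p,x_1,\dots,x_N)$ are defined by re-expanding the same polynomials in powers of $u$: $P(t)=\sum_{k=0}^{N+2}d_k(p)u^k$, $W(t)=\sum_{k=0}^{N+1}e_k(p)u^k$. The integrals are $$I_n=\int_0^1t^nK(t)\,dt\quad(n\in\mathbb Z,\ n\ge0),\qquad I_{n,p}=\int_0^1(1-pt)^nK(t)\,dt\quad(n\in\mathbb Z).$$ *)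

(* Defs.v *)
From HB Require Import structures.
From mathcomp Require Import all_boot all_order all_algebra.
(* mpoly is not imported: its notations clash with those of mathcomp-analysis *)
From mathcomp Require mpoly.
From mathcomp Require Import all_classical all_reals all_analysis.

Set Implicit Arguments.
Unset Strict Implicit.
Unset Printing Implicit Defensive.

Import Order.TTheory GRing.Theory Num.Theory.
Import numFieldNormedType.Exports.

Local Open Scope classical_set_scope.
Local Open Scope ring_scope.

Definition polyP (R : realType) (N : nat) (x : 'I_N -> R) : {poly R} :=
  'X * (1 - 'X) * \prod_(i < N) (1 - x i *: 'X).

Definition polyW (R : realType) (N : nat) (beta1 beta2 : R)
    (alpha x : 'I_N -> R) : {poly R} :=
  (beta1 + 1) *: ((1 - 'X) * \prod_(j < N) (1 - x j *: 'X))
  - (beta2 + 1) *: ('X * \prod_(j < N) (1 - x j *: 'X))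
  - \sum_(l < N) ((alpha l + 1) * x l) *:
      ('X * (1 - 'X) * \prod_(j < N | j != l) (1 - x j *: 'X)).

(* With u = 1 - p t, i.e. t = (1 - u) / p, this is Q(t) written as a polynomial
   in u; meaningful for p != 0 only. See [reexpandP] and [reexpand_unique]. *)
Definition reexpand (R : realType) (p : R) (Q : {poly R}) : {poly R} :=
  Q \Po (p^-1 *: (1 - 'X)).

Definition dcoef (R : realType) (N : nat) (x : 'I_N -> R) (k : nat) : R :=
  (polyP x)`_k.

Definition ecoef (R : realType) (N : nat) (beta1 beta2 : R)
    (alpha x : 'I_N -> R) (k : nat) : R :=
  (polyW beta1 beta2 alpha x)`_k.

Definition dcoefp (R : realType) (N : nat) (p : R) (x : 'I_N -> R)
    (k : nat) : R :=
  (reexpand p (polyP x))`_k.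

Definition ecoefp (R : realType) (N : nat) (beta1 beta2 : R)
    (alpha : 'I_N -> R) (p : R) (x : 'I_N -> R) (k : nat) : R :=
  (reexpand p (polyW beta1 beta2 alpha x))`_k.

(* e_{k-1}(p), with e_{-1}(p) = 0 *)
Definition ecoefp_pred (R : realType) (N : nat) (beta1 beta2 : R)
    (alpha : 'I_N -> R) (p : R) (x : 'I_N -> R) (k : nat) : R :=
  if k is k'.+1 then ecoefp beta1 beta2 alpha p x k' else 0.

Definition kernelK (R : realType) (N : nat) (beta1 beta2 : R)
    (alpha x : 'I_N -> R) (t : R) : R :=
  t `^ beta1 * (1 - t) `^ beta2 * \prod_(i < N) (1 - x i * t) `^ alpha i.

(* The integrals are over the open interval, since the integrands may be
   singular at the endpoints. *)
Definition intI (R : realType) (N : nat) (beta1 beta2 : R)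
    (alpha x : 'I_N -> R) (n : nat) : R :=
  \int[lebesgue_measure]_(t in `]0, 1[) (t ^+ n * kernelK beta1 beta2 alpha x t).

Definition intIp (R : realType) (N : nat) (beta1 beta2 : R)
    (alpha x : 'I_N -> R) (n : int) (p : R) : R :=
  \int[lebesgue_measure]_(t in `]0, 1[)
    ((1 - p * t) ^ n * kernelK beta1 beta2 alpha x t).

Definition is_polynomial (R : realType) (N : nat)
    (f : ('I_N -> R) -> R) : Prop :=
  exists A : mpoly.mpoly N R, forall x, f x = mpoly.meval x A.

(* f is given on p != 0 by an element A / B of R(p)[x_1, ..., x_N], with A in
   R[p][x_1, ..., x_N] and B in R[p] having no root other than 0. *)
Definition is_polynomial_rational (R : realType) (N : nat)
    (f : R -> ('I_N -> R) -> R) : Prop :=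
  exists (A : mpoly.mpoly N {poly R}) (B : {poly R}),
    forall p : R, p != 0 -> B.[p] != 0 /\
      forall x, f p x = (mpoly.meval (fun i => (x i)%:P) A).[p] / B.[p].

Lemma size_1subX (R : realType) : size (1 - 'X : {poly R}) = 2.
Proof. by rewrite -opprB size_polyN -polyC1 size_XsubC. Qed.

Lemma reexpandP (R : realType) (p : R) (Q : {poly R}) (m : nat) :
  p != 0 -> (size Q <= m)%N ->
  forall t, Q.[t] = \sum_(k < m) (reexpand p Q)`_k * (1 - p * t) ^+ k.
Proof.
move=> p0 sQ t.
have sr : (size (reexpand p Q) <= m)%N.
  rewrite /reexpand size_comp_poly2 //.
  by rewrite size_scale ?invr_eq0 // size_1subX.
rewrite -(horner_coef_wide _ sr) /reexpand horner_comp !hornerE.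
by rewrite opprB addrC subrK mulrA mulVf // mul1r.
Qed.

Lemma reexpand_unique (R : realType) (p : R) (Q : {poly R}) (m : nat)
    (c : nat -> R) :
  p != 0 -> (forall t, Q.[t] = \sum_(k < m) c k * (1 - p * t) ^+ k) ->
  forall k, (k < m)%N -> c k = (reexpand p Q)`_k.
Proof.
move=> p0 Qc k km.
suff -> : reexpand p Q = \poly_(i < m) c i by rewrite coef_poly km.
have ext (A B : {poly R}) : (forall u, A.[u] = B.[u]) -> A = B.
  move=> AB; apply/eqP; rewrite -subr_eq0; apply/eqP.
  apply: (@roots_geq_poly_eq0 _ _ [seq i%:R | i <- iota 0 (size (A - B))]).
  - by apply/allP => u _; rewrite rootE !hornerE AB subrr.
  - by rewrite map_inj_uniq ?iota_uniq //; exact: mulrIn (oner_neq0 R).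
  - by rewrite size_map size_iota.
apply: ext => u; rewrite /reexpand horner_comp Qc horner_poly.
apply: eq_bigr => i _; congr (_ * _ ^+ _).
by rewrite hornerZ hornerD hornerN hornerX hornerC mulrA divff // mul1r subKr.
Qed.

Lemma size_lin_prod (R : realType) (N : nat) (S : pred 'I_N) (x : 'I_N -> R) :
  (size (\prod_(i < N | S i) (1 - x i *: 'X))%R <= #|S|.+1)%N.
Proof.
have sl i : (size (1 - x i *: 'X)%R <= 2)%N.
  rewrite (leq_trans (size_polyD _ _)) // size_polyN geq_max size_poly1 /=.
  by rewrite (leq_trans (size_scale_leq _ _)) // size_polyX.
apply: (leq_trans (size_poly_prod_leq _ _)); rewrite leq_subLR.
rewrite addnS ltnS addnn -muln2 -sum_nat_const.
exact: leq_sum.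
Qed.

Lemma size_polyP (R : realType) (N : nat) (x : 'I_N -> R) :
  (size (polyP x) <= N.+3)%N.
Proof.
rewrite /polyP; apply: (leq_trans (size_polyMleq _ _)).
have := size_lin_prod xpredT x; rewrite card_ord.
have : (size ('X * (1 - 'X) : {poly R})%R <= 3)%N.
  apply: (leq_trans (size_polyMleq _ _)).
  by rewrite size_polyX size_1subX.
by move=> h1 h2; rewrite -subn1 leq_subLR (leq_trans (leq_add h1 h2)).
Qed.

Lemma dcoef0 (R : realType) (N : nat) (x : 'I_N -> R) : dcoef x 0 = 0.
Proof. by rewrite /dcoef /polyP -mulrA coefXM. Qed.

Lemma size_polyW (R : realType) (N : nat) (beta1 beta2 : R)
    (alpha x : 'I_N -> R) :
  (size (polyW beta1 beta2 alpha x) <= N.+2)%N.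
Proof.
have s1X : (size (1 - 'X : {poly R})%R <= 2)%N.
  by rewrite size_1subX.
have sX : (size ('X : {poly R}) <= 2)%N by rewrite size_polyX.
have sM (A B : {poly R}) a b : (size A <= a)%N -> (size B <= b.+1)%N ->
    (size (A * B)%R <= a + b)%N.
  move=> h1 h2; apply: (leq_trans (size_polyMleq _ _)).
  by rewrite -subn1 leq_subLR (leq_trans (leq_add h1 h2)) // addnS.
have sP := size_lin_prod xpredT x; rewrite card_ord in sP.
have sB (A B : {poly R}) m : (size A <= m)%N -> (size B <= m)%N ->
    (size (A - B)%R <= m)%N.
  by move=> h1 h2; rewrite (leq_trans (size_polyD _ _)) // size_polyN geq_max h1.
rewrite /polyW; apply: (sB); first apply: (sB).
- by apply: (leq_trans (size_scale_leq _ _)); exact: (sM _ _ 2%N N).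
- by apply: (leq_trans (size_scale_leq _ _)); exact: (sM _ _ 2%N N).
apply: (leq_trans (size_sum _ _ _)); apply/bigmax_leqP => l _.
apply: (leq_trans (size_scale_leq _ _)).
have N0 : (0 < N)%N by case: (N) l => [[]|].
have -> : N.+2 = (3 + N.-1)%N by rewrite -[in LHS](prednK N0).
apply: (sM _ _ 3%N N.-1); first exact: (sM _ _ 2%N 1%N).
apply: (leq_trans (size_lin_prod _ _)); rewrite ltnS.
by have := cardC1 l; rewrite card_ord => <-; rewrite subset_leq_card.
Qed.

(* Main.v *)
Require Import Defs.
From mathcomp Require Import all_boot all_order all_algebra.
From mathcomp Require mpoly.
From mathcomp Require Import all_classical all_reals all_analysis.
From mathcomp Require Import measurable_realfun ring lra.
Import (canonicals) mpoly.
Import Order.TTheory GRing.Theory Num.Theory.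
Import numFieldNormedType.Exports.

(** All three families of relations are one identity,
    [int_0^1 W(t) K(t) dt = 0], read at shifted exponents.

    The identity itself holds because [W] is [P] times the logarithmic
    derivative of [P K] (lemma [polyW_logderivK]), so that [W K = (P K)'], while
    [P K] is again a kernel, with every exponent raised by one
    ([polyP_kernelK]): for [beta1, beta2 > -1] it vanishes at 0 and at 1.  The
    integrand may be unbounded at the endpoints, so the fundamental theorem of
    calculus is needed in an improper form ([improper_FTC]), whose price is the
    integrability of [K] ([integrable_kernelK]); the latter is reduced to that
    of [t^a] and of [(1 - t)^b] by the inequality
    [t^a (1 - t)^b <= t^a + (1 - t)^b] ([le_powR_onem]).

    A monomial weight only changes the exponents of the kernel: [t^n K] has
    [beta1 + n] in place of [beta1]; [(1 - t)^n K] has [beta2 + n] in place of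
    [beta2]; and for [p < 1], [(1 - p t)^n K] is the kernel with one more
    parameter [p], of exponent [n].  Writing [W] for these new exponents in
    terms of the old [W] and [P] turns the identity into
    [int (t W + n P) t^(n-1) K = 0] ([integral_shift_t]) and
    [int (u W - n p P) u^(n-1) K = 0], where [u = 1 - p t]
    ([integral_shift_affine]).  Expanding [W] and [P] in powers of [t],
    respectively [u], and integrating term by term gives the relations: when
    [1/p] is a root of [P], which is the case for [p = 1] and [p = x_i], [P] has
    no constant term in [u] and the sum is shorter by one term.

    Polynomiality is inherited by coefficients: the families of polynomials in
    [t] whose coefficients are polynomials in [x_1, ..., x_N] are closed under
    ring operations.  In the re-expanded case, [t = (1 - u) / p] only brings in
    powers of [1/p], bounded by the degree, so a power of [p] is a common
    denominator. *)

Set Implicit Arguments.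
Unset Strict Implicit.
Local Open Scope classical_set_scope.
Local Open Scope ring_scope.

(** * The fundamental theorem of calculus on an open interval *)

(** The function [F] minus the indefinite integral of [f] is continuous on the
    closed interval, because [f] is integrable there, and has zero derivative
    inside; by the mean value theorem it takes the same value at both ends. *)
Lemma improper_FTC (R : realType) (f F : R -> R) (a b : R) : a < b ->
  (@lebesgue_measure R).-integrable `]a, b[ (EFin \o f) ->
  {in `]a, b[, continuous f} ->
  {within `[a, b], continuous F} ->
  (forall t, t \in `]a, b[ -> is_derive t 1 F (f t)) ->
  \int[lebesgue_measure]_(t in `]a, b[) f t = F b - F a.
Proof.
move=> ab fi fc Fc dF.
have mf : measurable_fun `]a, b[ f.
  by case/integrableP : fi => /measurable_EFinP.
have fi' : (@lebesgue_measure R).-integrable `[a, b] (EFin \o f).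
  move: fi => /integrableP[_ fi]; apply/integrableP; split.
    apply/measurable_EFinP/measurable_fun_itv_obnd_cbndP.
    exact/measurable_fun_itv_bndo_bndcP.
  rewrite integral_itv_bndoo//; apply: measurableT_comp => //.
  exact/measurable_EFinP.
pose G (x : R) := \int[lebesgue_measure]_(t in `[a, x]) f t.
have Gc : {within `[a, b], continuous G}.
  by have := parameterized_integral_continuous (ltW ab) fi'.
have dG t : t \in `]a, b[ -> is_derive t 1 (F - G) 0.
  move=> tab; have [at_ tb] : a < t /\ t < b by rewrite !(itvP tab).
  have [G1 G2] := continuous_FTC1_closed tb fi' at_ (fc t tab).
  have GD : is_derive t 1 G (f t) by apply: DeriveDef => //; rewrite -derive1E.
  by have := dF t tab => ?; apply: is_derive_eq; rewrite subrr.
have [|c _] := MVT ab dG.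
  by move=> x; apply: cvgB; [exact: Fc|exact: Gc].
rewrite mul0r !fctE => /eqP; rewrite subr_eq0 => /eqP FG.
have Ga : G a = 0 by rewrite /G set_itv1 Rintegral_set1.
have Gb : G b = \int[lebesgue_measure]_(t in `]a, b[) f t.
  by rewrite /G /Rintegral integral_itv_bndoo//; exact/measurable_EFinP.
by move: FG; rewrite Ga Gb subr0 => <-; rewrite subKr.
Qed.

(** On the segments exhausting the interval, the integrals of [f] are increments
    of the nondecreasing function [F], hence are bounded by [F b - F a]; monotone
    convergence carries the bound over to the whole interval. *)
Lemma integrable_of_antiderivative (R : realType) (f F : R -> R) (a b : R) :
  a < b ->
  {in `]a, b[, forall t, 0 <= f t} ->
  {in `]a, b[, continuous f} ->
  {within `[a, b], continuous F} ->
  (forall t, t \in `]a, b[ -> is_derive t 1 F (f t)) ->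
  (@lebesgue_measure R).-integrable `]a, b[ (EFin \o f).
Proof.
move=> ab f0 fc Fc dF.
have mf : measurable_fun `]a, b[ f.
  apply: open_continuous_measurable_fun => //.
  by move=> x; rewrite inE; exact: fc.
have Fle x y : x \in `[a, b] -> y \in `[a, b] -> x <= y -> F x <= F y.
  move=> xab yab xy; apply: (ger0_derive1_le _ _ Fc) => // t tab.
    by have [] := dF t tab.
  by rewrite derive1E (@derive_val _ _ _ _ _ _ _ (dF t tab)) f0.
pose D (n : nat) := `[a + n.+1%:R^-1, b - n.+1%:R^-1]%classic.
have DE n t : D n t <-> a + n.+1%:R^-1 <= t <= b - n.+1%:R^-1.
  by rewrite /D /= in_itv.
have n0 n : 0 < n.+1%:R^-1 :> R by rewrite invr_gt0.
have Dab n : D n `<=` `]a, b[.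
  move=> t /DE /andP[h1 h2]; rewrite /= in_itv /=.
  by rewrite (lt_le_trans _ h1) ?ltrDl// (le_lt_trans h2)// gtrBl.
have ndD : nondecreasing_seq D.
  apply/nondecreasing_seqP => n; rewrite subsetEset => t /DE /andP[h1 h2].
  have h : n.+2%:R^-1 <= n.+1%:R^-1 :> R by rewrite lef_pV2 ?posrE// ler_nat.
  by apply/DE; rewrite (le_trans _ h1) ?lerD2l// (le_trans h2)// lerD2l lerN2.
have UD : \bigcup_n D n = `]a, b[%classic.
  apply/seteqP; split => [t [n _]|t]; first exact: Dab.
  rewrite /= in_itv /= => /andP[h1 h2].
  have [n hn] : exists n : nat, n.+1%:R^-1 < Num.min (t - a) (b - t).
    have m0 : 0 < Num.min (t - a) (b - t) by rewrite lt_min !subr_gt0 h1.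
    have [n _ /(_ n (leqnn n))] := near_infty_natSinv_lt (PosNum m0).
    by exists n.
  move: hn; rewrite lt_min => /andP[h3 h4]; exists n => //; apply/DE/andP.
  by split; [rewrite addrC -lerBrDr ltW|rewrite lerBrDr addrC -lerBrDr ltW].
apply/integrableP; split; first exact/measurable_EFinP.
under eq_integral => t /[!inE] tab do rewrite /= ger0_norm ?f0//.
have bound n :
    (\int[lebesgue_measure]_(t in D n) (f t)%:E <= (F b - F a)%:E)%E.
  have Fab0 : 0 <= F b - F a by rewrite subr_ge0 Fle ?in_itv/= ?lexx ?ltW.
  (* for small n the segment D n can be empty or reduced to a point *)
  have [h|h] := ltP (a + n.+1%:R^-1) (b - n.+1%:R^-1); last first.
    apply: (@le_trans _ _ 0%E); last by rewrite lee_fin.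
    move: h; rewrite /D le_eqVlt => /predU1P[->|h].
      by rewrite set_itv1 integral_set1.
    by rewrite set_itv_ge ?integral_set0// bnd_simp -ltNge.
  have sub t : t \in `[a + n.+1%:R^-1, b - n.+1%:R^-1] -> t \in `]a, b[.
    exact: (Dab n).
  have subo t : t \in `]a + n.+1%:R^-1, b - n.+1%:R^-1[ -> t \in `]a, b[.
    by move=> tab; apply: sub; apply: subset_itv_oo_cc tab.
  have subc t : t \in `]a, b[ -> t \in `[a, b] by apply: subset_itv_oo_cc.
  have la : a + n.+1%:R^-1 \in `[a, b].
    by rewrite subc// sub// in_itv /= lexx ltW.
  have lb : b - n.+1%:R^-1 \in `[a, b].
    by rewrite subc// sub// in_itv /= lexx ltW.
  rewrite (@continuous_FTC2 _ f F)//.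
  - have aab : a \in `[a, b] by rewrite in_itv/= lexx ltW.
    have bab : b \in `[a, b] by rewrite in_itv/= lexx ltW.
    by rewrite -EFinB lee_fin lerB// Fle// ?(itvP lb) ?(itvP la).
  - by apply: continuous_in_subspaceT => t /[!inE]; move=> /sub; exact: fc.
  - have Fc' : {within `[a + n.+1%:R^-1, b - n.+1%:R^-1], continuous F}.
      by apply: continuous_subspaceW Fc => t /sub/subc.
    move/continuous_within_itvP : Fc' => /(_ h)[_ ? ?]; split=> // t /subo tab.
    by have [] := dF t tab.
  - move=> t /subo tab.
    by rewrite derive1E (@derive_val _ _ _ _ _ _ _ (dF t tab)).
rewrite -UD.
have cvgD : (\int[lebesgue_measure]_(t in D n) (f t)%:E @[n --> \oo] -->
    \int[lebesgue_measure]_(t in \bigcup_n D n) (f t)%:E)%E.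
  apply: ge0_nondecreasing_set_cvg_integral => //.
  - by move=> n; exact: measurable_itv.
  - by move=> n; apply/measurable_EFinP; apply: measurable_funS mf.
  - by move=> n t /Dab tab; rewrite lee_fin f0.
rewrite -(cvg_lim _ cvgD)//; apply: (@le_lt_trans _ _ (F b - F a)%:E).
  by apply: lime_le; [exact: cvgP cvgD|exact: nearW].
by rewrite ltry.
Qed.

Lemma bounded_continuous (R : realType) (f : R -> R) (a b : R) :
  {within `[a, b], continuous f} -> [bounded f x | x in `[a, b]].
Proof.
move=> fc.
have /compact_bounded[M [_ mrt]] :=
  continuous_compact fc (@segment_compact _ a b).
by exists M; split; rewrite ?num_real // => ? ? ? ?; exact: mrt.
Qed.

Lemma integrableM_continuous (R : realType) (f g : R -> R) (a b : R) :
  (@lebesgue_measure R).-integrable `]a, b[ (EFin \o f) ->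
  {within `[a, b], continuous g} ->
  (@lebesgue_measure R).-integrable `]a, b[ (EFin \o (fun t => f t * g t)).
Proof.
move=> fi gc.
have [M [Mr Mb]] := bounded_continuous gc.
have sub : `]a, b[ `<=` `[a, b] by move=> x; exact: subset_itv_oo_cc.
apply: (integrableMl _ fi) => //.
  apply: measurable_funS sub _ => //.
  exact: subspace_continuous_measurable_fun.
by exists M; split => // e /Mb h x /sub; exact: h.
Qed.

Lemma sum_Rintegral d (T : measurableType d) (R : realType)
    (mu : {measure set T -> \bar R}) (D : set T) (m : nat) (c : nat -> R)
    (g : nat -> T -> R) :
  measurable D ->
  (forall k, (k < m)%N -> mu.-integrable D (EFin \o g k)) ->
  \sum_(k < m) c k * \int[mu]_(t in D) g k t =
  \int[mu]_(t in D) (\sum_(k < m) c k * g k t).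
Proof.
move=> mD; elim: m => [|m IH] gi.
  rewrite big_ord0; under eq_Rintegral do rewrite big_ord0.
  by rewrite Rintegral_cst// mul0r.
rewrite big_ord_recr /= IH => [|k km]; last by apply: gi; exact: ltnW.
rewrite -RintegralZl//; last exact: gi.
under [in RHS]eq_Rintegral do rewrite big_ord_recr /=.
rewrite RintegralD//; last first.
  have := integrableZl mD (c m) (gi m (ltnSn m)); exact.
rewrite (_ : _ \o _ = fun t => (\sum_(k < m) (c k * g k t)%:E)%E); last first.
  by apply/funext => t /=; rewrite sumEFin.
apply: integrable_sum => // k _.
have := integrableZl mD (c k) (gi k (ltnW (ltn_ord k))); exact.
Qed.

(** * The logarithmic derivative of the kernel *)

Lemma is_derive_continuous (R : realType) (f : R -> R) (t d : R) :
  is_derive t 1 f d -> {for t, continuous f}.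
Proof.
by case=> df _; exact/differentiable_continuous/derivable1_diffP.
Qed.

Lemma affine_gt0 (R : realType) (y t : R) :
  y < 1 -> 0 <= t <= 1 -> 0 < 1 - y * t.
Proof.
move=> y1 /andP[t0 t1]; have [->|tn] := eqVneq t 0; first by rewrite mulr0 subr0.
have tp : 0 < t by rewrite lt_neqAle eq_sym tn.
have : 0 < (1 - y) * t by rewrite mulr_gt0 ?subr_gt0.
lra.
Qed.

(** Derivatives are given as the function times a logarithmic derivative: in
    this form a product only adds up the second factors
    ([is_derive_prod_log]). *)
Lemma is_derive_powR_affine (R : realType) (a y t : R) : 0 < 1 - y * t ->
  is_derive t 1 (fun s => (1 - y * s) `^ a)
    ((1 - y * t) `^ a * - (a * y / (1 - y * t))).
Proof.
move=> u0.
have D : is_derive t 1 (fun s : R => 1 - y * s) (- y).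
  by apply: is_derive_eq; rewrite add0r mul1r /GRing.scale /= mulr1.
have := @is_derive1_comp R (fun u => u `^ a) (fun s => 1 - y * s) t _ _
  (is_derive1_powR a u0) D.
move=> H; apply: (is_derive_eq H).
rewrite powRB; last by rewrite (gt_eqF u0) implybT.
by rewrite powRr1 ?ltW// /GRing.scale /=; field; exact: lt0r_neq0.
Qed.

Lemma is_derive_powR_onem (R : realType) (a t : R) : t < 1 ->
  is_derive t 1 (fun s => (1 - s) `^ a) ((1 - t) `^ a * - (a / (1 - t))).
Proof.
rewrite -subr_gt0 -{1}(mul1r t) => t1.
have := is_derive_powR_affine a t1.
by under eq_fun do rewrite mul1r; rewrite mul1r mulr1.
Qed.

Lemma is_derive_prod_log (R : realType) (I : Type) (r : seq I)
    (f : I -> R -> R) (l : I -> R) (t : R) :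
  (forall i, is_derive t 1 (f i) (f i t * l i)) ->
  is_derive t 1 (fun s => \prod_(i <- r) f i s)
    ((\prod_(i <- r) f i t) * \sum_(i <- r) l i).
Proof.
move=> df; elim: r => [|i r IH].
  rewrite !big_nil mulr0; under eq_fun do rewrite big_nil.
  exact: is_derive_cst.
rewrite !big_cons; under eq_fun do rewrite big_cons.
apply: (is_derive_eq (is_deriveM (df i) IH)).
by rewrite /GRing.scale /=; ring.
Qed.

Definition logderivK (R : realType) (N : nat) (b1 b2 : R)
    (alpha x : 'I_N -> R) (t : R) : R :=
  b1 / t - b2 / (1 - t) - \sum_(l < N) alpha l * x l / (1 - x l * t).

Lemma is_derive_kernelK (R : realType) (N : nat) (b1 b2 : R)
    (alpha x : 'I_N -> R) (t : R) :
  (forall i, x i < 1) -> t \in `]0, 1[ ->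
  is_derive t 1 (kernelK b1 b2 alpha x)
    (kernelK b1 b2 alpha x t * logderivK b1 b2 alpha x t).
Proof.
move=> x1; rewrite in_itv /= => /andP[t0 t1].
have D1 : is_derive t 1 (fun s : R => s `^ b1) (t `^ b1 * (b1 / t)).
  apply: (is_derive_eq (is_derive1_powR b1 t0)).
  rewrite powRB; last by rewrite (gt_eqF t0) implybT.
  by rewrite powRr1 ?ltW//; field; rewrite gt_eqF.
have D2 := is_derive_powR_onem b2 t1.
have D3 : is_derive t 1 (fun s => \prod_(i < N) (1 - x i * s) `^ alpha i)
    ((\prod_(i < N) (1 - x i * t) `^ alpha i)
     * \sum_(i < N) - (alpha i * x i / (1 - x i * t))).
  apply: is_derive_prod_log => i; apply: is_derive_powR_affine.
  by rewrite affine_gt0// !ltW.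
rewrite /kernelK; apply: (is_derive_eq (is_deriveM (is_deriveM D1 D2) D3)).
by rewrite /logderivK sumrN /GRing.scale /= !fctE; ring.
Qed.

(** * Continuity and integrability of the kernel *)

Lemma cvg_powR_onem (R : realType) (c : R) :
  0 < c -> (1 - t) `^ c @[t --> 1^'-] --> 0.
Proof.
move=> c0.
have h : (1 - t : R) @[t --> 1^'-] --> 0^'+.
  move=> A; rewrite /at_right /at_left => -[e /= e0 Ae].
  exists e => //= t /= te t1; apply: Ae => /=; last by rewrite subr_gt0.
  by rewrite sub0r normrN.
exact: (cvg_comp _ _ h (powR_cvg0 c0)).
Qed.

Lemma continuous_kernelK (R : realType) (N : nat) (b1 b2 : R)
    (alpha x : 'I_N -> R) :
  (forall i, x i < 1) -> {in `]0, 1[, continuous (kernelK b1 b2 alpha x)}.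
Proof.
move=> x1 t t01.
exact: is_derive_continuous (is_derive_kernelK b1 b2 alpha x1 t01).
Qed.

Lemma continuous_prod_powR (R : realType) (N : nat) (alpha x : 'I_N -> R)
    (t : R) :
  (forall i, x i < 1) -> t \in `[0, 1] ->
  {for t, continuous (fun s => \prod_(i < N) (1 - x i * s) `^ alpha i)}.
Proof.
move=> x1; rewrite in_itv => t01.
have D i : is_derive t 1 (fun s => (1 - x i * s) `^ alpha i) _ :=
  is_derive_powR_affine (alpha i) (affine_gt0 (x1 i) t01).
exact: is_derive_continuous (is_derive_prod_log (index_enum 'I_N) D).
Qed.

Lemma within_continuous_kernelK (R : realType) (N : nat) (b1 b2 : R)
    (alpha x : 'I_N -> R) :
  (forall i, x i < 1) -> 0 < b1 -> 0 < b2 ->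
  {within `[0, 1], continuous (kernelK b1 b2 alpha x)}.
Proof.
move=> x1 b10 b20; apply/continuous_within_itvP => //.
split; first exact: continuous_kernelK.
- rewrite {2}/kernelK powR0 ?gt_eqF// !mul0r.
  have H1 : (1 - t) `^ b2 @[t --> (0:R)^'+] --> (1 - (0:R)) `^ b2.
    have c1 : {for 0, continuous (fun t : R => (1 - t) `^ b2)}.
      exact: is_derive_continuous (is_derive_powR_onem b2 ltr01).
    exact: cvg_at_right_filter c1.
  have H2 := cvg_at_right_filter
    (continuous_prod_powR (alpha := alpha) x1 (_ : 0 \in `[0, 1])).
  rewrite -[X in _ --> X](mul0r (\prod_(i < N) (1 - x i * 0) `^ alpha i)).
  rewrite -[X in X * _](mul0r ((1 - 0) `^ b2)).
  apply: cvgM; first by apply: cvgM; [exact: powR_cvg0|exact: H1].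
  by apply: H2; rewrite in_itv /= lexx ler01.
- rewrite {2}/kernelK subrr powR0 ?gt_eqF// mulr0 mul0r.
  have H1 : t `^ b1 @[t --> (1:R)^'-] --> (1:R) `^ b1.
    have c1 : {for 1, continuous (fun t : R => t `^ b1)}.
      exact: is_derive_continuous (is_derive1_powR b1 ltr01).
    exact: cvg_at_left_filter c1.
  have H2 := cvg_at_left_filter
    (continuous_prod_powR (alpha := alpha) x1 (_ : 1 \in `[0, 1])).
  rewrite -[X in _ --> X](mul0r (\prod_(i < N) (1 - x i * 1) `^ alpha i)).
  rewrite -[X in X * _](mulr0 (1 `^ b1)).
  apply: cvgM; first by apply: cvgM; [exact: H1|exact: cvg_powR_onem].
  by apply: H2; rewrite in_itv /= lexx ler01.
Qed.

Lemma integrable_powR (R : realType) (c : R) : -1 < c ->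
  (@lebesgue_measure R).-integrable `]0, 1[ (EFin \o (fun t => t `^ c)).
Proof.
move=> c1; have c0 : 0 < c + 1 by rewrite -ltrBlDr sub0r.
pose F t : R := (c + 1)^-1 * t `^ (c + 1).
have D (t : R) : 0 < t -> is_derive t 1 F (t `^ c).
  move=> t0.
  have D1 := is_deriveZ (c + 1)^-1 (is_derive1_powR (c + 1) t0).
  apply: (is_derive_eq D1).
  by rewrite /GRing.scale /= mulrA mulVf ?gt_eqF// mul1r addrK.
apply: (@integrable_of_antiderivative _ _ F) => //.
- by move=> t _; exact: powR_ge0.
- move=> t; rewrite in_itv => /andP[t0 _].
  exact: is_derive_continuous (is_derive1_powR c t0).
- apply/continuous_within_itvP => //; split.
  + move=> t; rewrite in_itv => /andP[t0 _].
    exact: is_derive_continuous (D t t0).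
  + rewrite /F powR0 ?gt_eqF// mulr0 -[X in _ --> X](mulr0 (c + 1)^-1).
    by apply: cvgM; [exact: cvg_cst|exact: powR_cvg0].
  + exact: cvg_at_left_filter (is_derive_continuous (D 1 ltr01)).
- by move=> t; rewrite in_itv => /andP[t0 _]; exact: D.
Qed.

Lemma integrable_powR_onem (R : realType) (c : R) : -1 < c ->
  (@lebesgue_measure R).-integrable `]0, 1[ (EFin \o (fun t => (1 - t) `^ c)).
Proof.
move=> c1; have c0 : 0 < c + 1 by rewrite -ltrBlDr sub0r.
pose F t : R := - (c + 1)^-1 * (1 - t) `^ (c + 1).
have D (t : R) : t < 1 -> is_derive t 1 F ((1 - t) `^ c).
  move=> t1.
  have D1 := is_deriveZ (- (c + 1)^-1) (is_derive_powR_onem (c + 1) t1).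
  apply: (is_derive_eq D1).
  have u0 : 1 - t != 0 by rewrite gt_eqF// subr_gt0.
  rewrite powRD ?u0 ?implybT// powRr1 ?subr_ge0 ?ltW// /GRing.scale /=; field.
  by rewrite u0 gt_eqF.
apply: (@integrable_of_antiderivative _ _ F) => //.
- by move=> t _; exact: powR_ge0.
- move=> t; rewrite in_itv => /andP[_ t1].
  exact: is_derive_continuous (is_derive_powR_onem c t1).
- apply/continuous_within_itvP => //; split.
  + move=> t; rewrite in_itv => /andP[_ t1].
    exact: is_derive_continuous (D t t1).
  + exact: cvg_at_right_filter (is_derive_continuous (D 0 ltr01)).
  + rewrite /F subrr powR0 ?gt_eqF// mulr0.
    rewrite -[X in _ --> X](mulr0 (- (c + 1)^-1)).
    by apply: cvgM; [exact: cvg_cst|exact: cvg_powR_onem].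
- by move=> t; rewrite in_itv => /andP[_ t1]; exact: D.
Qed.

(** Multiply the left side by [1 = (1 - t) + t]: each of the two resulting terms
    has one factor of positive exponent, which is at most 1.  This separates the
    two endpoint singularities without cutting the interval. *)
Lemma le_powR_onem (R : realType) (a b t : R) :
  -1 < a -> -1 < b -> 0 < t -> t < 1 ->
  t `^ a * (1 - t) `^ b <= t `^ a + (1 - t) `^ b.
Proof.
move=> a1 b1 t0 t1.
have u0 : 0 < 1 - t by rewrite subr_gt0.
have shift (c s : R) : -1 < c -> 0 < s -> s <= 1 -> s `^ c * s <= 1.
  move=> c1 s0 s1; rewrite -{2}(powRr1 (ltW s0)) -powRD; last first.
    by rewrite (gt_eqF s0) implybT.
  rewrite -[leRHS](powRr0 s); apply: ger_powR; first by rewrite s0.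
  by rewrite -lerBlDr sub0r ltW.
have -> : t `^ a * (1 - t) `^ b =
    t `^ a * ((1 - t) `^ b * (1 - t)) + t `^ a * t * (1 - t) `^ b by ring.
apply: lerD; first by rewrite ler_piMr ?powR_ge0// shift// gerBl ltW.
by rewrite ler_piMl ?powR_ge0// shift// ltW.
Qed.

Lemma integrable_kernelK (R : realType) (N : nat) (b1 b2 : R)
    (alpha x : 'I_N -> R) :
  (forall i, x i < 1) -> -1 < b1 -> -1 < b2 ->
  (@lebesgue_measure R).-integrable `]0, 1[ (EFin \o kernelK b1 b2 alpha x).
Proof.
move=> x1 b11 b21.
apply: (@integrableM_continuous _ (fun t => t `^ b1 * (1 - t) `^ b2)); last first.
  apply: continuous_in_subspaceT => t /[!inE] t01.
  exact: (continuous_prod_powR (alpha := alpha) x1 t01).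
apply: (@le_integrable _ _ _ (@lebesgue_measure R) `]0, 1[ _ _
  (EFin \o (fun t => t `^ b1 + (1 - t) `^ b2))).
- exact: measurable_itv.
- apply/measurable_EFinP; apply: measurable_funM.
    by apply: measurable_funTS; exact: measurable_powR.
  by case/integrableP: (integrable_powR_onem b21) => /measurable_EFinP.
- move=> t; rewrite /= in_itv => /andP[t0 t1].
  rewrite lee_fin !ger0_norm ?addr_ge0 ?mulr_ge0 ?powR_ge0//.
  exact: le_powR_onem.
- have := integrableD _ (integrable_powR b11) (integrable_powR_onem b21).
  by apply.
Qed.

(** * The basic identity *)

Lemma horner_prod_affine (R : realType) (N : nat) (S : pred 'I_N)
    (x : 'I_N -> R) (t : R) :
  (\prod_(i < N | S i) (1 - x i *: 'X)).[t] = \prod_(i < N | S i) (1 - x i * t).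
Proof. by rewrite horner_prod; apply: eq_bigr => i _; rewrite !hornerE. Qed.

Lemma horner_polyP (R : realType) (N : nat) (x : 'I_N -> R) (t : R) :
  (Defs.polyP x).[t] = t * (1 - t) * \prod_(i < N) (1 - x i * t).
Proof. by rewrite /Defs.polyP hornerM horner_prod_affine !hornerE. Qed.

(** [W] is the numerator of the logarithmic derivative of [P K] over the common
    denominator [P]. *)
Lemma polyW_logderivK (R : realType) (N : nat) (b1 b2 : R)
    (alpha x : 'I_N -> R) (t : R) :
  (forall i, x i < 1) -> t \in `]0, 1[ ->
  (polyW b1 b2 alpha x).[t] =
  (Defs.polyP x).[t]
    * logderivK (b1 + 1) (b2 + 1) (fun i => alpha i + 1) x t.
Proof.
move=> x1; rewrite in_itv /= => /andP[t0 t1].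
have tn0 : t != 0 by rewrite gt_eqF.
have un0 : 1 - t != 0 by rewrite gt_eqF// subr_gt0.
have sumE : \sum_(l < N) ((alpha l + 1) * x l)
      * (t * (1 - t) * \prod_(j < N | j != l) (1 - x j * t)) =
    t * (1 - t) * (\prod_(i < N) (1 - x i * t))
      * \sum_(l < N) (alpha l + 1) * x l / (1 - x l * t).
  rewrite mulr_sumr; apply: eq_bigr => l _; rewrite [in RHS](bigD1 l)//=.
  have ln0 : 1 - x l * t != 0 by rewrite gt_eqF// affine_gt0// !ltW.
  by field.
rewrite horner_polyP /polyW !hornerD !hornerN !hornerZ !hornerM.
rewrite horner_prod_affine horner_sum.
under [X in _ - X = _]eq_bigr do rewrite hornerZ !hornerM horner_prod_affine.
rewrite !hornerE sumE /logderivK /=; field.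
by rewrite tn0 un0.
Qed.

Lemma polyP_kernelK (R : realType) (N : nat) (b1 b2 : R)
    (alpha x : 'I_N -> R) (t : R) :
  (forall i, x i < 1) -> t \in `]0, 1[ ->
  (Defs.polyP x).[t] * kernelK b1 b2 alpha x t =
  kernelK (b1 + 1) (b2 + 1) (fun i => alpha i + 1) x t.
Proof.
move=> x1; rewrite in_itv /= => /andP[t0 t1].
have powS (c s : R) : 0 < s -> s `^ (c + 1) = s * s `^ c.
  by move=> s0; rewrite powRD ?(gt_eqF s0) ?implybT// powRr1 ?ltW// mulrC.
rewrite horner_polyP /kernelK !powS ?subr_gt0//.
under [in RHS]eq_bigr => i _ do rewrite powS ?affine_gt0 ?ltW//.
by rewrite big_split /=; ring.
Qed.

(** The integrand is the derivative of [P K], which vanishes at both ends. *)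
Lemma integral_polyW_kernelK (R : realType) (N : nat) (b1 b2 : R)
    (alpha x : 'I_N -> R) :
  (forall i, x i < 1) -> -1 < b1 -> -1 < b2 ->
  \int[lebesgue_measure]_(t in `]0, 1[)
    ((polyW b1 b2 alpha x).[t] * kernelK b1 b2 alpha x t) = 0.
Proof.
move=> x1 b11 b21.
set K1 := kernelK (b1 + 1) (b2 + 1) (fun i => alpha i + 1) x.
have b10 : 0 < b1 + 1 by rewrite -ltrBlDr sub0r.
have b20 : 0 < b2 + 1 by rewrite -ltrBlDr sub0r.
have cW : continuous (fun t => (polyW b1 b2 alpha x).[t]).
  exact: continuous_horner.
transitivity (K1 1 - K1 0); last first.
  by rewrite /K1 /kernelK subrr !powR0 ?gt_eqF// !(mul0r, mulr0) subrr.
apply: improper_FTC => //.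
- rewrite (_ : _ \o _ = EFin \o
    fun t => kernelK b1 b2 alpha x t * (polyW b1 b2 alpha x).[t]); last first.
    by apply/funext => t /=; rewrite mulrC.
  apply: integrableM_continuous; first exact: integrable_kernelK.
  exact: continuous_subspaceT.
- by move=> t t01; apply: cvgM; [exact: cW|exact: continuous_kernelK].
- exact: within_continuous_kernelK.
- move=> t t01; apply: (is_derive_eq (is_derive_kernelK _ _ _ x1 t01)).
  by rewrite polyW_logderivK// -polyP_kernelK//; ring.
Qed.

(** * Weights as shifted exponents *)

Lemma kernelK_shift1 (R : realType) (N : nat) (b1 b2 : R)
    (alpha x : 'I_N -> R) (n : int) (t : R) : 0 < t ->
  t ^ n * kernelK b1 b2 alpha x t = kernelK (b1 + n%:~R) b2 alpha x t.
Proof.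
move=> t0.
rewrite /kernelK powRD ?(gt_eqF t0) ?implybT// powR_intmul ?ltW//.
by ring.
Qed.

Lemma kernelK_shift2 (R : realType) (N : nat) (b1 b2 : R)
    (alpha x : 'I_N -> R) (n : int) (t : R) : t < 1 ->
  (1 - t) ^ n * kernelK b1 b2 alpha x t = kernelK b1 (b2 + n%:~R) alpha x t.
Proof.
rewrite -subr_gt0 => t0.
rewrite /kernelK powRD ?(gt_eqF t0) ?implybT// powR_intmul ?ltW//.
by ring.
Qed.

Definition fcons (T : Type) (N : nat) (y : T) (f : 'I_N -> T) (i : 'I_N.+1) :=
  oapp f y (unlift ord0 i).

Lemma fcons0 (T : Type) (N : nat) (y : T) (f : 'I_N -> T) :
  fcons y f ord0 = y.
Proof. by rewrite /fcons unlift_none. Qed.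

Lemma fconsS (T : Type) (N : nat) (y : T) (f : 'I_N -> T) i :
  fcons y f (lift ord0 i) = f i.
Proof. by rewrite /fcons liftK. Qed.

Lemma fcons_lt (R : realType) (N : nat) (y b : R) (f : 'I_N -> R) :
  y < b -> (forall i, f i < b) -> forall i, fcons y f i < b.
Proof. by move=> yb fb i; rewrite /fcons; case: unliftP => [j _|_] /=. Qed.

Lemma kernelK_fcons (R : realType) (N : nat) (b1 b2 : R)
    (alpha x : 'I_N -> R) (n : int) (p t : R) : 0 < 1 - p * t ->
  (1 - p * t) ^ n * kernelK b1 b2 alpha x t =
  kernelK b1 b2 (fcons n%:~R alpha) (fcons p x) t.
Proof.
move=> u0; rewrite /kernelK big_ord_recl !fcons0 powR_intmul ?ltW//.
under [in RHS]eq_bigr do rewrite !fconsS.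
by ring.
Qed.

Lemma polyP_fcons (R : realType) (N : nat) (x : 'I_N -> R) (p t : R) :
  (Defs.polyP (fcons p x)).[t] = (1 - p * t) * (Defs.polyP x).[t].
Proof.
rewrite !horner_polyP big_ord_recl fcons0.
under [in LHS]eq_bigr do rewrite fconsS.
by ring.
Qed.

Lemma logderivK_fcons (R : realType) (N : nat) (b1 b2 a : R)
    (alpha x : 'I_N -> R) (p t : R) :
  logderivK b1 b2 (fun i => fcons a alpha i + 1) (fcons p x) t =
  logderivK b1 b2 (fun i => alpha i + 1) x t - (a + 1) * p / (1 - p * t).
Proof.
rewrite /logderivK big_ord_recl !fcons0.
under [in LHS]eq_bigr do rewrite !fconsS.
by rewrite opprD addrA addrAC.
Qed.

Lemma exprz_pred (F : fieldType) (u : F) (n : int) :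
  u != 0 -> u ^ n = u ^ (n - 1) * u.
Proof. by move=> u0; rewrite -{3}(expr1z u) -expfzDr// subrK. Qed.

Section shift.
Variables (R : realType) (N : nat) (b1 b2 : R) (alpha x : 'I_N -> R).
Hypothesis x1 : forall i, x i < 1.

Let P t := (Defs.polyP x).[t].
Let W t := (polyW b1 b2 alpha x).[t].
Let K := kernelK b1 b2 alpha x.

Lemma integral_shift_t (n : int) : -1 < b1 + n%:~R -> -1 < b2 ->
  \int[lebesgue_measure]_(t in `]0, 1[)
    ((t * W t + n%:~R * P t) * t ^ (n - 1) * K t) = 0.
Proof.
move=> b11 b21.
rewrite -[RHS](integral_polyW_kernelK alpha x1 b11 b21).
apply: eq_Rintegral => t; rewrite inE /= => t01.
have /andP[t0 t1] : 0 < t < 1 by move: t01; rewrite in_itv.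
have tn0 : t != 0 by rewrite gt_eqF.
have un0 : 1 - t != 0 by rewrite gt_eqF// subr_gt0.
rewrite /W /P !polyW_logderivK// -(kernelK_shift1 _ _ _ _ n t0) /logderivK.
rewrite (exprz_pred n tn0) -/(K t).
by field; rewrite tn0 un0.
Qed.

Lemma integral_shift_affine (n : int) (p : R) : -1 < b1 ->
  p < 1 /\ -1 < b2 \/ p = 1 /\ -1 < b2 + n%:~R ->
  \int[lebesgue_measure]_(t in `]0, 1[)
    (((1 - p * t) * W t - n%:~R * p * P t) * (1 - p * t) ^ (n - 1) * K t) = 0.
Proof.
move=> b11 [[p1 b21]|[-> b21]].
  (* The new parameter gets exponent n - 1, since W involves the exponents
     increased by one and P acquires the factor 1 - p t. *)
- rewrite -[RHS](integral_polyW_kernelK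
    (fcons (n - 1)%:~R alpha) (fcons_lt p1 x1) b11 b21).
  apply: eq_Rintegral => t; rewrite inE /= => t01.
  have /andP[t0 t1] : 0 < t < 1 by move: t01; rewrite in_itv.
  have u0 : 0 < 1 - p * t by rewrite affine_gt0// !ltW.
  have un0 : 1 - p * t != 0 by rewrite gt_eqF.
  rewrite /W /P !polyW_logderivK//; last exact: fcons_lt.
  rewrite -kernelK_fcons// polyP_fcons logderivK_fcons -/(K t).
  by rewrite rmorphB /=; field.
- rewrite -[RHS](integral_polyW_kernelK alpha x1 b11 b21).
  apply: eq_Rintegral => t; rewrite inE /= => t01.
  have /andP[t0 t1] : 0 < t < 1 by move: t01; rewrite in_itv.
  have tn0 : t != 0 by rewrite gt_eqF.
  have un0 : 1 - t != 0 by rewrite gt_eqF// subr_gt0.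
  rewrite /W /P !polyW_logderivK// -(kernelK_shift2 _ _ _ _ n t1) /logderivK.
  rewrite mul1r (exprz_pred n un0) -/(K t).
  by field; rewrite tn0 un0.
Qed.

Lemma integrable_kernelK_t (n : nat) : -1 < b1 -> -1 < b2 ->
  (@lebesgue_measure R).-integrable `]0, 1[ (EFin \o (fun t => t ^+ n * K t)).
Proof.
move=> b11 b21; have b11' : -1 < b1 + (n%:Z)%:~R by rewrite ltr_wpDr// ler0z.
apply: eq_integrable (integrable_kernelK alpha x1 b11' b21) => // t.
rewrite inE /= in_itv => /andP[t0 t1].
by rewrite -kernelK_shift1.
Qed.

Lemma integrable_kernelK_affine (n : int) (k : nat) (p : R) : -1 < b1 ->
  p < 1 /\ -1 < b2 \/ p = 1 /\ -1 < b2 + n%:~R ->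
  (@lebesgue_measure R).-integrable `]0, 1[
    (EFin \o (fun t => (1 - p * t) ^ (k%:Z + n) * K t)).
Proof.
move=> b11 [[p1 b21]|[-> b21]].
- apply: eq_integrable (integrable_kernelK
    (fcons (k%:Z + n)%:~R alpha) (fcons_lt p1 x1) b11 b21) => // t.
  rewrite inE /= in_itv => /andP[t0 t1].
  by rewrite -kernelK_fcons// affine_gt0// !ltW.
- have b21' : -1 < b2 + (k%:Z + n)%:~R.
    by rewrite rmorphD /= addrCA ltr_wpDl// ler0z.
  apply: eq_integrable (integrable_kernelK alpha x1 b11 b21') => // t.
  rewrite inE /= in_itv => /andP[t0 t1].
  by rewrite -kernelK_shift2// mul1r.
Qed.
End shift.

(** * The relations between the integrals *)

(** Term by term integration: it turns a pointwise expansion of the weight [h]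
    into a linear relation between the moments of the kernel. *)
Lemma sum_moments (R : realType) (N m : nat) (b1 b2 : R) (alpha x : 'I_N -> R)
    (c : nat -> R) (g : nat -> R -> R) (h : R -> R) :
  (forall k, (k < m)%N ->
     (@lebesgue_measure R).-integrable `]0, 1[
       (EFin \o (fun t => g k t * kernelK b1 b2 alpha x t))) ->
  (forall t, 0 < t < 1 -> \sum_(k < m) c k * g k t = h t) ->
  \int[lebesgue_measure]_(t in `]0, 1[)
    (h t * kernelK b1 b2 alpha x t) = 0 ->
  \sum_(k < m) c k * \int[lebesgue_measure]_(t in `]0, 1[)
    (g k t * kernelK b1 b2 alpha x t) = 0.
Proof.
move=> gi ch int0; rewrite -[RHS]int0.
rewrite (sum_Rintegral c _ gi); last exact: measurable_itv.
apply: eq_Rintegral => t; rewrite inE /= in_itv /= => /ch <-.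
by rewrite mulr_suml; apply: eq_bigr => k _; rewrite mulrA.
Qed.

Lemma polyP_dcoef (R : realType) (N : nat) (x : 'I_N -> R) (t : R) :
  (Defs.polyP x).[t] = t * \sum_(k < N.+2) dcoef x k.+1 * t ^+ k.
Proof.
rewrite (horner_coef_wide _ (size_polyP x)) big_ord_recl.
rewrite -[X in X * _]/(dcoef x 0) dcoef0 mul0r add0r mulr_sumr.
by apply: eq_bigr => k _; rewrite exprS mulrCA.
Qed.

(** The constant term in [u = 1 - p t] is the value at [u = 0], that is at
    [t = 1/p]. *)
Lemma polyP_dcoefp (R : realType) (N : nat) (x : 'I_N -> R) (p t : R) :
  p != 0 -> (Defs.polyP x).[p^-1] = 0 ->
  (Defs.polyP x).[t] =
  (1 - p * t) * \sum_(k < N.+2) dcoefp p x k.+1 * (1 - p * t) ^+ k.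
Proof.
move=> p0 Pp; rewrite (reexpandP p0 (size_polyP x)) big_ord_recl.
have -> : (reexpand p (Defs.polyP x))`_(ord0 : 'I_N.+3) = 0.
  rewrite -horner_coef0 /reexpand horner_comp hornerZ hornerD hornerN hornerX.
  by rewrite hornerC oppr0 addr0 mulr1.
rewrite mul0r add0r mulr_sumr.
by apply: eq_bigr => k _; rewrite exprS mulrCA.
Qed.

Lemma relation_intI (R : realType) (N : nat) (b1 b2 : R) (alpha x : 'I_N -> R)
    (n : nat) :
  (forall i, x i < 1) -> -1 < b1 -> -1 < b2 ->
  \sum_(k < N.+2) (n%:R * dcoef x k.+1 + ecoef b1 b2 alpha x k)
    * intI b1 b2 alpha x (k + n) = 0.
Proof.
move=> x1 b11 b21.
have b11' : -1 < b1 + (n%:Z)%:~R by rewrite ltr_wpDr// ler0z.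
apply: (sum_moments (c := fun k => n%:R * dcoef x k.+1 + ecoef b1 b2 alpha x k)
  (g := fun k t => t ^+ (k + n)) _ _ (integral_shift_t alpha x1 b11' b21)).
  by move=> k _; exact: integrable_kernelK_t.
move=> t /andP[t0 _].
rewrite polyP_dcoef (horner_coef_wide _ (size_polyW _ _ _ _)).
have tn0 : t != 0 by rewrite gt_eqF.
rewrite mulrCA -mulrDr mulrAC [X in _ = X * _]mulrC -exprz_pred// mulr_sumr.
rewrite -big_split mulr_sumr; apply: eq_bigr => k _ /=.
by rewrite exprD /ecoef -exprnP; ring.
Qed.

Lemma relation_intIp (R : realType) (N : nat) (b1 b2 : R) (alpha x : 'I_N -> R)
    (n : int) (p : R) :
  (forall i, x i < 1) -> -1 < b1 -> -1 < b2 -> p < 1 -> p != 0 ->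
  \sum_(k < N.+3)
    (- n%:~R * p * dcoefp p x k + ecoefp_pred b1 b2 alpha p x k)
    * intIp b1 b2 alpha x (k%:Z + n - 1) p = 0.
Proof.
move=> x1 b11 b21 p1 p0.
have cond m : p < 1 /\ -1 < b2 \/ p = 1 /\ -1 < b2 + m%:~R by left.
apply: (sum_moments
  (c := fun k => - n%:~R * p * dcoefp p x k + ecoefp_pred b1 b2 alpha p x k)
  (g := fun k t => (1 - p * t) ^ (k%:Z + n - 1)) _ _
  (integral_shift_affine alpha x1 b11 (cond n))).
  by move=> k _; rewrite -addrA; exact: integrable_kernelK_affine.
move=> t t01; have un0 : 1 - p * t != 0.
  by rewrite gt_eqF// affine_gt0//; case/andP: t01 => *; rewrite !ltW.
rewrite (reexpandP p0 (size_polyP x)).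
rewrite (reexpandP p0 (size_polyW b1 b2 alpha x)).
under eq_bigr do rewrite mulrDl.
rewrite big_split /= [X in _ + X = _]big_ord_recl mul0r add0r.
rewrite mulrBl mulr_sumr mulr_sumr mulr_suml addrC; congr (_ + _).
  apply: eq_bigr => k _; rewrite -addrA expfzDr// lift0 /=.
  by rewrite -exprnP exprS /ecoefp; ring.
rewrite mulr_suml -sumrN; apply: eq_bigr => k _.
by rewrite -addrA expfzDr// -exprnP /dcoefp; ring.
Qed.

Lemma relation_intIp_root (R : realType) (N : nat) (b1 b2 : R)
    (alpha x : 'I_N -> R) (n : int) (p : R) :
  (forall i, x i < 1) -> -1 < b1 ->
  p < 1 /\ -1 < b2 \/ p = 1 /\ -1 < b2 + n%:~R ->
  p != 0 -> (Defs.polyP x).[p^-1] = 0 ->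
  \sum_(k < N.+2)
    (- n%:~R * p * dcoefp p x k.+1 + ecoefp b1 b2 alpha p x k)
    * intIp b1 b2 alpha x (k%:Z + n) p = 0.
Proof.
move=> x1 b11 b21 p0 Pp.
apply: (sum_moments
  (c := fun k => - n%:~R * p * dcoefp p x k.+1 + ecoefp b1 b2 alpha p x k)
  (g := fun k t => (1 - p * t) ^ (k%:Z + n)) _ _
  (integral_shift_affine alpha x1 b11 b21)).
  by move=> k _; exact: integrable_kernelK_affine.
move=> t /andP[t0 t1]; have un0 : 1 - p * t != 0.
  case: b21 => [[p1 _]|[-> _]]; last by rewrite mul1r subr_eq0 gt_eqF.
  by rewrite gt_eqF// affine_gt0// !ltW.
rewrite (polyP_dcoefp _ p0 Pp) (reexpandP p0 (size_polyW b1 b2 alpha x)).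
rewrite mulrCA -mulrBr mulrAC [X in _ = X * _]mulrC -exprz_pred//.
rewrite mulr_sumr -sumrB mulr_sumr; apply: eq_bigr => k _ /=.
by rewrite expfzDr// /ecoefp -exprnP; ring.
Qed.

(** * Polynomial dependence on the parameters *)

Section mpolyfun.
Variables (R : realType) (N : nat) (S : comNzRingType).
Variable (phi : {rmorphism R -> S}).
Implicit Types (F G : ('I_N -> R) -> S) (P Q : ('I_N -> R) -> {poly R}).

(** The morphism [phi] serves both coefficient rings of the theorem: it is the
    identity for polynomials over [R], and the embedding of constants for
    polynomials over [R[p]]. *)
Definition mpolyfun F := exists A : mpoly.mpoly N S,
  forall x, F x = mpoly.meval (fun i => phi (x i)) A.

Lemma mpolyfun_cst (c : S) : mpolyfun (fun=> c).
Proof. by exists (mpoly.mpolyC N c) => x; rewrite mpoly.mevalC. Qed.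

Lemma mpolyfun_var (i : 'I_N) : mpolyfun (fun x => phi (x i)).
Proof.
by exists (mpoly.mpolyX S (mpoly.mnm1 i)) => x; rewrite mpoly.mevalXU.
Qed.

Lemma mpolyfunD F G :
  mpolyfun F -> mpolyfun G -> mpolyfun (fun x => F x + G x).
Proof.
by move=> [A fA] [B gB]; exists (A + B) => x; rewrite mpoly.mevalD fA gB.
Qed.

Lemma mpolyfunM F G :
  mpolyfun F -> mpolyfun G -> mpolyfun (fun x => F x * G x).
Proof.
by move=> [A fA] [B gB]; exists (A * B) => x; rewrite mpoly.mevalM fA gB.
Qed.

Lemma mpolyfun_sum (I : Type) (r : seq I) (T : pred I)
    (F : I -> ('I_N -> R) -> S) :
  (forall i, mpolyfun (F i)) -> mpolyfun (fun x => \sum_(i <- r | T i) F i x).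
Proof.
move=> pF; elim: r => [|i r IH].
  by under eq_fun do rewrite big_nil; exact: mpolyfun_cst.
under eq_fun do rewrite big_cons; case: (T i) => //.
exact: mpolyfunD.
Qed.

Definition mpoly_coefs P := forall k, mpolyfun (fun x => phi (P x)`_k).

Lemma mpoly_coefs_cst (p : {poly R}) : mpoly_coefs (fun=> p).
Proof. by move=> k; exact: mpolyfun_cst. Qed.

Lemma mpoly_coefs_var (i : 'I_N) : mpoly_coefs (fun x => (x i)%:P).
Proof.
move=> k; under eq_fun do rewrite coefC.
case: eqP => _; first exact: mpolyfun_var.
exact: mpolyfun_cst.
Qed.

Lemma mpoly_coefsD P Q :
  mpoly_coefs P -> mpoly_coefs Q -> mpoly_coefs (fun x => P x + Q x).
Proof.
by move=> pP pQ k; under eq_fun do rewrite coefD rmorphD; exact: mpolyfunD.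
Qed.

Lemma mpoly_coefsM P Q :
  mpoly_coefs P -> mpoly_coefs Q -> mpoly_coefs (fun x => P x * Q x).
Proof.
move=> pP pQ k; under eq_fun do rewrite coefM rmorph_sum.
apply: mpolyfun_sum => i; under eq_fun do rewrite rmorphM.
exact: mpolyfunM.
Qed.

Lemma mpoly_coefsN P : mpoly_coefs P -> mpoly_coefs (fun x => - P x).
Proof.
move=> pP; under eq_fun do rewrite -mulN1r.
by apply: mpoly_coefsM => //; exact: mpoly_coefs_cst.
Qed.

Lemma mpoly_coefs_sum (I : Type) (r : seq I) (T : pred I)
    (P : I -> ('I_N -> R) -> {poly R}) :
  (forall i, mpoly_coefs (P i)) ->
  mpoly_coefs (fun x => \sum_(i <- r | T i) P i x).
Proof.
move=> pP k; under eq_fun do rewrite coef_sum rmorph_sum.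
by apply: mpolyfun_sum => i; exact: pP.
Qed.

Lemma mpoly_coefs_prod (I : Type) (r : seq I) (T : pred I)
    (P : I -> ('I_N -> R) -> {poly R}) :
  (forall i, mpoly_coefs (P i)) ->
  mpoly_coefs (fun x => \prod_(i <- r | T i) P i x).
Proof.
move=> pP; elim: r => [|i r IH].
  by under eq_fun do rewrite big_nil; exact: mpoly_coefs_cst.
under eq_fun do rewrite big_cons; case: (T i) => //.
exact: mpoly_coefsM.
Qed.

Lemma mpoly_coefs_affine (i : 'I_N) : mpoly_coefs (fun x => 1 - x i *: 'X).
Proof.
apply: mpoly_coefsD; first exact: mpoly_coefs_cst.
apply: mpoly_coefsN; under eq_fun do rewrite -mul_polyC.
by apply: mpoly_coefsM; [exact: mpoly_coefs_var|exact: mpoly_coefs_cst].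
Qed.

Lemma mpoly_coefs_polyP : mpoly_coefs (fun x => Defs.polyP x).
Proof.
apply: mpoly_coefsM; first exact: mpoly_coefs_cst.
by apply: mpoly_coefs_prod => i; exact: mpoly_coefs_affine.
Qed.

Lemma mpoly_coefs_polyW (b1 b2 : R) (alpha : 'I_N -> R) :
  mpoly_coefs (polyW b1 b2 alpha).
Proof.
have pprodM (p : {poly R}) (T : pred 'I_N) :
    mpoly_coefs (fun x => p * \prod_(j < N | T j) (1 - x j *: 'X)).
  apply: mpoly_coefsM; first exact: mpoly_coefs_cst.
  by apply: mpoly_coefs_prod => i; exact: mpoly_coefs_affine.
have pZ (c : R) P : mpoly_coefs P -> mpoly_coefs (fun x => c *: P x).
  move=> pP; under eq_fun do rewrite -mul_polyC.
  by apply: mpoly_coefsM => //; exact: mpoly_coefs_cst.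
apply: mpoly_coefsD; first apply: mpoly_coefsD; first exact: pZ.
  by apply: mpoly_coefsN; exact: pZ.
apply: mpoly_coefsN; apply: mpoly_coefs_sum => l.
under eq_fun do rewrite -scalerA.
apply: pZ; under eq_fun do rewrite -mul_polyC.
by apply: mpoly_coefsM; [exact: mpoly_coefs_var|exact: pprodM].
Qed.
End mpolyfun.

Lemma coef_reexpand (R : realType) (p : R) (Q : {poly R}) (m k : nat) :
  (size Q <= m)%N ->
  (reexpand p Q)`_k =
  \sum_(j < m) Q`_j * (p^-1 ^+ j * ((1 - 'X) ^+ j)`_k).
Proof.
move=> sQ; rewrite /reexpand /comp_poly.
rewrite (@horner_coef_wide _ m) ?size_map_polyC//.
rewrite coef_sum; apply: eq_bigr => j _.
by rewrite coef_map /= coefCM exprZn coefZ.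
Qed.

(** By [coef_reexpand] the only denominators are the powers of [p] below the
    [m]-th, so multiplication by [p ^ m] makes the coefficient polynomial in
    [p] as well. *)
Lemma is_polynomial_rational_reexpand (R : realType) (N m : nat)
    (Q : ('I_N -> R) -> {poly R}) k :
  (forall x, (size (Q x) <= m)%N) -> mpoly_coefs polyC Q ->
  is_polynomial_rational (fun p x => (reexpand p (Q x))`_k).
Proof.
move=> sQ pQ.
have [A HA] : mpolyfun polyC (fun x => \sum_(j < m)
    ((Q x)`_j)%:P * (((1 - 'X) ^+ j)`_k *: 'X^(m - j))).
  apply: mpolyfun_sum => j.
  by apply: mpolyfunM; [exact: pQ|exact: mpolyfun_cst].
exists A, 'X^m => p p0; rewrite hornerXn expf_neq0//; split => // x.
rewrite -HA (coef_reexpand _ _ (sQ x)) horner_sum mulr_suml.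
apply: eq_bigr => j _.
have -> : p ^+ m = p ^+ (m - j) * p ^+ j by rewrite -exprD subnK// ltnW.
rewrite hornerM hornerC hornerZ hornerXn exprVn.
by field; rewrite !expf_neq0.
Qed.

Theorem theorem3p1 (R : realType) (N : nat) (hN : (1 <= N)%N)
    (beta1 beta2 : R) (alpha : 'I_N -> R) :
  (forall x : 'I_N -> R, (forall i, x i < 1) ->
     [/\ -1 < beta1 -> -1 < beta2 ->
         forall n : nat,
           \sum_(k < N.+2)
             (n%:R * dcoef x k.+1 + ecoef beta1 beta2 alpha x k)
             * intI beta1 beta2 alpha x (k + n) = 0,
         -1 < beta1 -> -1 < beta2 ->
         forall (n : int) (p : R), p < 1 -> p != 0 -> (forall i, p != x i) ->
           \sum_(k < N.+3)
             (- n%:~R * p * dcoefp p x k + ecoefp_pred beta1 beta2 alpha p x k)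
             * intIp beta1 beta2 alpha x (k%:Z + n - 1) p = 0
       & forall (n : int) (p : R),
           [/\ p = 1, -1 < beta1 & -1 < beta2 + n%:~R]
           \/ [/\ exists i, p = x i /\ x i != 0, -1 < beta1 & -1 < beta2] ->
           \sum_(k < N.+2)
             (- n%:~R * p * dcoefp p x k.+1 + ecoefp beta1 beta2 alpha p x k)
             * intIp beta1 beta2 alpha x (k%:Z + n) p = 0])
  /\ [/\ forall k, (1 <= k <= N + 2)%N ->
           is_polynomial (fun x : 'I_N -> R => dcoef x k),
         forall k, (k <= N + 1)%N ->
           is_polynomial (fun x : 'I_N -> R => ecoef beta1 beta2 alpha x k),
         forall k, (k <= N + 2)%N ->
           is_polynomial_rational (fun p (x : 'I_N -> R) => dcoefp p x k)
       & forall k, (k <= N + 1)%N ->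
           is_polynomial_rational
             (fun p (x : 'I_N -> R) => ecoefp beta1 beta2 alpha p x k)].
Proof.
split=> [x x1|].
  split=> [b11 b21 n|b11 b21 n p p1 p0 _|n p].
  - exact: relation_intI.
  - exact: relation_intIp.
  - have root_pV (i : 'I_N) : x i != 0 -> (Defs.polyP x).[(x i)^-1] = 0.
      by move=> xi0; rewrite horner_polyP (bigD1 i)//= divff// subrr mul0r mulr0.
    move=> [[-> b11 b21]|[[i [-> xi0]] b11 b21]]; apply: relation_intIp_root => //.
    + by right.
    + by rewrite invr1 horner_polyP subrr mulr0 mul0r.
    + by left.
    + exact: root_pV.
split=> k _.
- exact: (@mpoly_coefs_polyP R N R idfun).
- exact: (@mpoly_coefs_polyW R N R idfun).
- apply: (@is_polynomial_rational_reexpand R N N.+3 (fun x => Defs.polyP x) k).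
    exact: size_polyP.
  exact: mpoly_coefs_polyP.
- apply: (@is_polynomial_rational_reexpand R N N.+2 (polyW beta1 beta2 alpha) k).
    exact: size_polyW.
  exact: mpoly_coefs_polyW.
Qed.
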